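(* Let $n>3$ be an odd number such that $h=\frac{n-1}2$ is even. Let $T\in\mathcal{BC}^{0,1}(V_n)$. Then for $p,s\in\rho_{\mathcal F}(T)$ with $s\notin[p]$, writing $R=\mathcal F_n^R(s,T)$, $L=\mathcal F_n^L(p,T)$ and $|T|^2=T\overline T$, the following equation holds: $$\begin{aligned} &R\,S_L^{-1}(p,T)+S_R^{-1}(s,T)\,L\\ &\quad+\gamma_n\Big[-s\mathcal Q_s^{\frac{h+2}2}(T)\overline T\mathcal Q_p^{\frac{h+2}2}(T)-\mathcal Q_s^{\frac{h+2}2}(T)\overline T\mathcal Q_p^{\frac{h+2}2}(T)p+\mathcal Q_s^{\frac{h+2}2}(T)\overline T^2\mathcal Q_p^{\frac{h+2}2}(T)\\ &\quad+\sum_{i=0}^{h-1}\mathcal Q_s^{h-i}(T)\mathcal Q_p^{i+1}(T)+s\sum_{i=0,\,i\ne\frac{h-2}2}^{h-2}\mathcal Q_s^{h-i}(T)\mathcal Q_p^{i+2}(T)p-s\sum_{i=0,\,i\ne\frac{h-2}2}^{h-2}\mathcal Q_s^{h-i}(T)\overline T\mathcal Q_p^{i+2}(T)\\ &\quad-\sum_{i=0,\,i\ne\frac{h-2}2}^{h-2}\mathcal Q_s^{h-i}(T)\overline T\mathcal Q_p^{i+2}(T)p+\sum_{i=0,\,i\ne\frac{h-2}2}^{h-2}\mathcal Q_s^{h-i}(T)\overline T^2\mathcal Q_p^{i+2}(T)\Big]\\ &\quad+\gamma_n^{-1}\big[\mathcal A_1(s,p,T)+\mathcal B_1(s,p,T)+\mathcal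 C_1(s,p,T)+s^hRLp^h\big]\\ &=\big\{[R-L]p-\overline s[R-L]\big\}(p^2-2s_0p+|s|^2)^{-1}, \end{aligned}$$ where, with $M=\frac{h-2}2$ (sums over an empty range being $0$), $$\mathcal A_1(s,p,T)=-s^hRTLp^{h-1}-s^{h-1}RTLp^h+s^{h-1}RT^2Lp^{h-1},$$ $$\begin{aligned} \mathcal B_1(s,p,T)={}&s^hR\sum_{k=1}^{M}\binom Mk(|T|^2-2T_0p)^kLp^{h-2k}-s^hR\sum_{k=1}^{M}\binom Mk(|T|^2-2T_0p)^kTLp^{h-1-2k}\\ &-s^{h-1}R\sum_{k=1}^{M}\binom MkT(|T|^2-2T_0p)^kLp^{h-2k}+s^{h-1}R\sum_{k=1}^{M}\binom MkT(|T|^2-2T_0p)^kTLp^{h-1-2k}, \end{aligned}$$ $$\begin{aligned} \mathcal C_1(s,p,T)={}&\Big(\sum_{k=1}^{M}\binom Mks^{h-2k}R(|T|^2-2T_0s)^k\Big)\Big(\sum_{k=1}^{M}\binom Mk(|T|^2-2T_0p)^kLp^{h-2k}\Big)\\ &-\Big(\sum_{k=1}^{M}\binom Mks^{h-2k}R(|T|^2-2T_0s)^k\Big)\Big(\sum_{k=1}^{M}\binom Mk(|T|^2-2T_0p)^kTLp^{h-1-2k}\Big)\\ &-\Big(\sum_{k=1}^{M}\binom Mks^{h-2k-1}RT(|T|^2-2T_0s)^k\Big)\Big(\sum_{k=1}^{M}\binom Mk(|T|^2-2T_0p)^kLp^{h-2k}\Big)\\ &+\Big(\sum_{k=1}^{M}\binom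 Mks^{h-2k-1}RT(|T|^2-2T_0s)^k\Big)\Big(\sum_{k=1}^{M}\binom Mk(|T|^2-2T_0p)^kTLp^{h-1-2k}\Big)\\ &+\Big(\sum_{k=1}^{M}\binom Mks^{h-2k}R(|T|^2-2T_0s)^k\Big)Lp^h-\Big(\sum_{k=1}^{M}\binom Mks^{h-2k}R(|T|^2-2T_0s)^kT\Big)Lp^{h-1}\\ &-\Big(\sum_{k=1}^{M}\binom Mks^{h-1-2k}RT(|T|^2-2T_0s)^k\Big)Lp^h+\Big(\sum_{k=1}^{M}\binom Mks^{h-1-2k}RT(|T|^2-2T_0s)^kT\Big)Lp^{h-1}. \end{aligned}$$
   Context: $\mathbb R_n$ is the real Clifford algebra generated by $e_1,\dots,e_n$ with $e_\ell^2=-1$ and $e_\ell e_m+e_me_\ell=0$ for $\ell\neq m$. A point of $\mathbb R^{n+1}$ is identified with the paravector $x=x_0+\underline x$, $\underline x=\sum_{j=1}^n x_je_j$; $\overline x=x_0-\underline x$, $|x|^2=\sum_{j=0}^nx_j^2$. $\mathbb S$ is the set of $\underline x$ with $|\underline x|=1$ and $[x]=\{x_0+J|\underline x|:J\in\mathbb S\}$. $V$ is a real Banach space, $V_n=V\otimes\mathbb R_n$ is the associated two-sided Banach module over $\mathbb R_n$, and $\mathcal B(V_n)$ is the space of bounded right linear operators on $V_n$. Clifford numbers act on operators by $(aT)(v)=a\,T(v)$, $(Ta)(v)=T(av)$; products of operators are compositions. $\mathcal{BC}^{0,1}(V_n)$ is the set of paravector operators $T=T_0+\sum_{\ell=1}^n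 e_\ell T_\ell$ with pairwise commuting components $T_\ell\in\mathcal B(V)$ (acting componentwise on $V_n$). Put $\overline T=T_0-\sum_{\ell=1}^n e_\ell T_\ell$, so that $T+\overline T=2T_0$ and $T\overline T=\sum_{\ell=0}^nT_\ell^2$. $\rho_{\mathcal F}(T)$ is the set of $s\in\mathbb R^{n+1}$ such that $s^2\mathcal I-s(T+\overline T)+T\overline T$ is invertible in $\mathcal B(V_n)$. For $s\in\rho_{\mathcal F}(T)$: $\mathcal Q_s(T)=(s^2\mathcal I-s(T+\overline T)+T\overline T)^{-1}$, $\mathcal Q_s^k(T)=(\mathcal Q_s(T))^k$, $S_L^{-1}(s,T)=(s\mathcal I-\overline T)\mathcal Q_s(T)$, $S_R^{-1}(s,T)=\mathcal Q_s(T)(s\mathcal I-\overline T)$, $\mathcal F_n^L(s,T)=\gamma_n(s\mathcal I-\overline T)\mathcal Q_s(T)^{\frac{n+1}2}$, $\mathcal F_n^R(s,T)=\gamma_n\mathcal Q_s(T)^{\frac{n+1}2}(s\mathcal I-\overline T)$, where $\gamma_n=(-1)^{\frac{n-1}2}2^{n-1}\big[\big(\frac{n-1}2\big)!\big]^2$. *)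

(* Defs.v *)
From HB Require Import structures.
From mathcomp Require Import all_boot all_order all_algebra all_field.
From mathcomp Require Import boolp classical_sets functions reals normedtype.

Set Implicit Arguments.
Unset Strict Implicit.
Unset Printing Implicit Defensive.

Import Order.TTheory GRing.Theory Num.Theory.

Local Open Scope ring_scope.

(* The basis blade e_A (A a subset of {1..n}) is the product of the e_i, i in A,
   in increasing order of the indices, so that
     e_A e_B = blade_sign A B * e_(A symdiff B):
   each j of B crosses the i > j of A, and meets itself if j is in A, giving
   one factor -1 for every pair j <= i. *)
Definition symdiff n (A B : {set 'I_n}) : {set 'I_n} := (A :\: B) :|: (B :\: A).

Definition blade_sign (K : realType) n (A B : {set 'I_n}) : K :=
  \prod_(i in A) \prod_(j in B | (j <= i)%N) (-1).

(* V_n = V (x) R_n : the family v stands for the sum over A of v_A (x) e_A. *)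
Definition Vn (K : realType) (V : completeNormedModType K) n := {ffun {set 'I_n} -> V}.
HB.instance Definition _ (K : realType) (V : completeNormedModType K) n :=
  GRing.Lmodule.on (Vn V n).

Definition clifford (K : realType) n := {ffun {set 'I_n} -> K^o}.
HB.instance Definition _ (K : realType) n := Vector.on (clifford K n).

Section BladeSign.
Context {K : realType} {n : nat}.
Implicit Types A B C : {set 'I_n}.

Lemma in_symdiff A B i : (i \in symdiff A B) = (i \in A) (+) (i \in B).
Proof. by rewrite !inE; case: (i \in A); case: (i \in B). Qed.

Lemma symdiffC A B : symdiff A B = symdiff B A.
Proof. by apply/setP => i; rewrite !in_symdiff addbC. Qed.

Lemma symdiffA A B C : symdiff A (symdiff B C) = symdiff (symdiff A B) C.
Proof. by apply/setP => i; rewrite !in_symdiff addbA. Qed.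

Lemma symdiffK A : involutive (symdiff A).
Proof. by move=> B; apply/setP => i; rewrite !in_symdiff addKb. Qed.

Lemma symdiff0 A : symdiff finset.set0 A = A.
Proof. by apply/setP => i; rewrite in_symdiff inE. Qed.

Lemma symdiffKA A B C : symdiff (symdiff A B) (symdiff A C) = symdiff B C.
Proof. by rewrite (symdiffC A B) -symdiffA symdiffK. Qed.

Lemma symdiff_eqE A B C : (symdiff A B == C) = (B == symdiff A C).
Proof. by apply/eqP/eqP => [<-|->]; rewrite symdiffK. Qed.

Lemma symdiff_eqEr A B C : (symdiff A B == C) = (A == symdiff B C).
Proof. by rewrite symdiffC symdiff_eqE. Qed.

Lemma blade_signE A B : blade_sign K A B =
  \prod_i \prod_j (-1) ^+ [&& i \in A, j \in B & (j <= i)%N].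
Proof.
rewrite /blade_sign big_mkcond; apply: eq_bigr => i _.
case: (i \in A); last by rewrite big1.
by rewrite big_mkcond; apply: eq_bigr => j _ /=; case: (_ && _).
Qed.

Lemma blade_sign_symdiffl A B C :
  blade_sign K (symdiff A B) C = blade_sign K A C * blade_sign K B C.
Proof.
rewrite !blade_signE -big_split; apply: eq_bigr => i _ /=.
rewrite -big_split; apply: eq_bigr => j _ /=.
rewrite in_symdiff -signr_addb; congr ((-1) ^+ nat_of_bool _).
by case: (i \in A); case: (i \in B); rewrite /= ?addbb ?addbF.
Qed.

Lemma blade_sign_symdiffr A B C :
  blade_sign K A (symdiff B C) = blade_sign K A B * blade_sign K A C.
Proof.
rewrite !blade_signE -big_split; apply: eq_bigr => i _ /=.
rewrite -big_split; apply: eq_bigr => j _ /=.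
rewrite in_symdiff -signr_addb; congr ((-1) ^+ nat_of_bool _).
by case: (i \in A); case: (j \in B); case: (j \in C); rewrite /= ?addbb ?addbF.
Qed.

Lemma blade_sign0l A : blade_sign K finset.set0 A = 1.
Proof. by rewrite /blade_sign big_set0. Qed.

Lemma blade_sign0r A : blade_sign K A finset.set0 = 1.
Proof. by rewrite /blade_sign big1 // => i _; rewrite big1 // => j; rewrite inE. Qed.

Lemma blade_signA A B C :
  blade_sign K A (symdiff A C) * blade_sign K B (symdiff B A) =
  blade_sign K B (symdiff B C) * blade_sign K (symdiff B A) (symdiff A C).
Proof.
rewrite blade_sign_symdiffl mulrA -blade_sign_symdiffr mulrC.
by rewrite (symdiffC B C) (symdiffC A C) symdiffKA.
Qed.

Lemma blade_signAr A B C :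
  blade_sign K B (symdiff B C) * blade_sign K A (symdiff A (symdiff B C)) =
  blade_sign K (symdiff B A) (symdiff (symdiff B A) C) * blade_sign K B A.
Proof.
rewrite symdiffA (symdiffC A B) blade_sign_symdiffl mulrAC -blade_sign_symdiffr.
congr (blade_sign K B _ * _); apply/setP => i; rewrite !in_symdiff.
by case: (i \in A); case: (i \in B); case: (i \in C).
Qed.

End BladeSign.

(* (sum_A a_A e_A) (sum_B v_B (x) e_B), on any real vector space of
   coefficients; with real coefficients it is the product of R_n. *)
Definition blade_mul (K : realType) (V : lmodType K) n
    (a : {ffun {set 'I_n} -> K^o}) (v : {ffun {set 'I_n} -> V}) :
    {ffun {set 'I_n} -> V} :=
  [ffun C => \sum_A \sum_(B | symdiff A B == C) (blade_sign K A B * a A) *: v B].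

(* (sum_A v_A (x) e_A) (sum_B b_B e_B) *)
Definition blade_mulr (K : realType) (V : lmodType K) n
    (v : {ffun {set 'I_n} -> V}) (b : {ffun {set 'I_n} -> K^o}) :
    {ffun {set 'I_n} -> V} :=
  [ffun C => \sum_A \sum_(B | symdiff A B == C) (blade_sign K A B * b B) *: v A].

Section BladeMul.
Context {K : realType} {V : lmodType K} {n : nat}.
Implicit Types (a b : {ffun {set 'I_n} -> K^o}) (u v : {ffun {set 'I_n} -> V}).

Lemma blade_mulE a v C : blade_mul a v C =
  \sum_A (blade_sign K A (symdiff A C) * a A) *: v (symdiff A C).
Proof.
rewrite ffunE; apply: eq_bigr => A _.
by rewrite (eq_bigl _ _ (fun B => symdiff_eqE A B C)) big_pred1_eq.
Qed.

Lemma blade_mulrE v b C : blade_mulr v b C =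
  \sum_A (blade_sign K A (symdiff A C) * b (symdiff A C)) *: v A.
Proof.
rewrite ffunE; apply: eq_bigr => A _.
by rewrite (eq_bigl _ _ (fun B => symdiff_eqE A B C)) big_pred1_eq.
Qed.

Lemma blade_mul_realE a b C : blade_mul (V := K^o) a b C =
  \sum_A blade_sign K A (symdiff A C) * a A * b (symdiff A C).
Proof.
rewrite ffunE; apply: eq_bigr => A _.
by rewrite (eq_bigl _ _ (fun B => symdiff_eqE A B C)) big_pred1_eq.
Qed.

Lemma blade_mulA a b v :
  blade_mul (blade_mul (V := K^o) a b) v = blade_mul a (blade_mul b v).
Proof.
apply/ffunP => C; rewrite !blade_mulE.
under eq_bigr => A _ do rewrite blade_mul_realE mulr_sumr scaler_suml.
rewrite exchange_big; apply: eq_bigr => B _ /=.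
rewrite blade_mulE scaler_sumr.
rewrite [RHS](reindex_inj (can_inj (symdiffK B))); apply: eq_bigr => A _ /=.
rewrite symdiffKA scalerA; congr (_ *: _).
rewrite mulrA mulrA blade_signA.
by rewrite -!mulrA; congr (_ * _); rewrite mulrCA.
Qed.

Lemma blade_mul_mulr a v b :
  blade_mul a (blade_mulr v b) = blade_mulr (blade_mul a v) b.
Proof.
apply/ffunP => C; rewrite blade_mulE blade_mulrE.
under eq_bigr => A _ do rewrite blade_mulrE scaler_sumr.
under [RHS]eq_bigr => A _ do rewrite blade_mulE scaler_sumr.
rewrite [RHS]exchange_big; apply: eq_bigr => B _ /=.
rewrite [RHS](reindex_inj (can_inj (symdiffK B))); apply: eq_bigr => A _ /=.
rewrite symdiffK !scalerA; congr (_ *: _).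
rewrite mulrACA blade_signAr [RHS]mulrACA; congr (_ * _).
by rewrite mulrC symdiffA (symdiffC A B).
Qed.

Lemma blade_mulDl a b v : blade_mul (a + b) v = blade_mul a v + blade_mul b v.
Proof.
apply/ffunP => C; rewrite [RHS]ffunE !blade_mulE -big_split; apply: eq_bigr => A _ /=.
by rewrite ffunE mulrDr scalerDl.
Qed.

Lemma blade_mulDr a u v : blade_mul a (u + v) = blade_mul a u + blade_mul a v.
Proof.
apply/ffunP => C; rewrite [RHS]ffunE !blade_mulE -big_split; apply: eq_bigr => A _ /=.
by rewrite ffunE scalerDr.
Qed.

Lemma blade_mulZl k a v : blade_mul (k *: a) v = k *: blade_mul a v.
Proof.
apply/ffunP => C; rewrite [RHS]ffunE !blade_mulE scaler_sumr; apply: eq_bigr => A _ /=.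
by rewrite ffunE scalerA mulrCA.
Qed.

Lemma blade_mulZr k a v : blade_mul a (k *: v) = k *: blade_mul a v.
Proof.
apply/ffunP => C; rewrite [RHS]ffunE !blade_mulE scaler_sumr; apply: eq_bigr => A _ /=.
by rewrite ffunE !scalerA mulrC.
Qed.

Lemma blade_mulrDl u v b : blade_mulr (u + v) b = blade_mulr u b + blade_mulr v b.
Proof.
apply/ffunP => C; rewrite [RHS]ffunE !blade_mulrE -big_split; apply: eq_bigr => A _ /=.
by rewrite ffunE scalerDr.
Qed.

Lemma blade_mulrZl k v b : blade_mulr (k *: v) b = k *: blade_mulr v b.
Proof.
apply/ffunP => C; rewrite [RHS]ffunE !blade_mulrE scaler_sumr; apply: eq_bigr => A _ /=.
by rewrite ffunE !scalerA mulrC.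
Qed.

Lemma blade_mul1 v : blade_mul [ffun A => (A == finset.set0)%:R] v = v.
Proof.
apply/ffunP => C; rewrite blade_mulE (bigD1 finset.set0) //= big1 => [|A /negPf A0].
  by rewrite ffunE eqxx symdiff0 blade_sign0l mulr1 scale1r addr0.
by rewrite ffunE A0 mulr0 scale0r.
Qed.
End BladeMul.

Section CliffordRing.
Context {K : realType} {n : nat}.
Local Notation Cl := (clifford K n).

Definition blade (A : {set 'I_n}) : Cl := [ffun B => (B == A)%:R].

Definition clifford_mul (a b : Cl) : Cl := blade_mul (V := K^o) a b.

Fact clifford_mulA : associative clifford_mul.
Proof. by move=> a b c; rewrite /clifford_mul blade_mulA. Qed.

Fact clifford_mul1 : left_id (blade finset.set0) clifford_mul.
Proof. by move=> a; rewrite /clifford_mul blade_mul1. Qed.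

Fact clifford_mulr1 : right_id (blade finset.set0) clifford_mul.
Proof.
move=> a; apply/ffunP => C; rewrite blade_mul_realE (bigD1 C) //= big1 => [|A AC].
  have -> : symdiff C C = finset.set0.
    by apply/setP => i; rewrite in_symdiff inE addbb.
  by rewrite blade_sign0r mul1r ffunE eqxx mulr1 addr0.
rewrite ffunE symdiff_eqE (symdiffC A finset.set0) symdiff0 eq_sym (negPf AC).
by rewrite mulr0.
Qed.

Fact clifford_mulDl : left_distributive clifford_mul +%R.
Proof. by move=> a b c; apply: blade_mulDl. Qed.

Fact clifford_mulDr : right_distributive clifford_mul +%R.
Proof. by move=> a b c; apply: blade_mulDr. Qed.

Fact clifford_oner_neq0 : blade finset.set0 != 0.
Proof.
apply/eqP => /ffunP/(_ finset.set0); rewrite !ffunE eqxx => /eqP.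
by rewrite oner_eq0.
Qed.

HB.instance Definition _ := GRing.Zmodule_isNzRing.Build Cl clifford_mulA
  clifford_mul1 clifford_mulr1 clifford_mulDl clifford_mulDr clifford_oner_neq0.

Fact clifford_scalerAl (k : K) (a b : Cl) : k *: (a * b) = (k *: a) * b.
Proof. by symmetry; apply: blade_mulZl. Qed.

HB.instance Definition _ := GRing.Lmodule_isLalgebra.Build K Cl clifford_scalerAl.

Fact clifford_scalerAr (k : K) (a b : Cl) : k *: (a * b) = a * (k *: b).
Proof. by symmetry; apply: blade_mulZr. Qed.

HB.instance Definition _ := GRing.Lalgebra_isAlgebra.Build K Cl clifford_scalerAr.

HB.instance Definition _ := Algebra_isFalgebra.Build K Cl.

Definition gen (l : 'I_n) : Cl := blade [set l].

Lemma blade_mulM A B :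
  blade A * blade B = blade_sign K A B *: blade (symdiff A B).
Proof.
apply/ffunP => C; rewrite [LHS]blade_mul_realE !ffunE.
rewrite (bigD1 A) //= big1 => [|D /negPf DA]; last by rewrite ffunE DA mulr0 mul0r.
rewrite !ffunE eqxx mulr1 addr0 symdiff_eqE.
by rewrite -[_ *: _]/(_ * _); case: eqP => [->|_]; rewrite ?symdiffK ?mulr0.
Qed.

Lemma gen_sqr l : gen l * gen l = -1.
Proof.
rewrite blade_mulM.
have -> : symdiff [set l] [set l] = finset.set0.
  by apply/setP => i; rewrite in_symdiff !inE addbb.
rewrite /blade_sign big_set1 (big_pred1 l) ?scaleN1r // => j.
by rewrite inE; apply: andb_idr => /eqP->.
Qed.

Lemma gen_anticomm l m : l != m -> gen l * gen m + gen m * gen l = 0.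
Proof.
move=> lm; rewrite !blade_mulM (symdiffC [set m]) -scalerDl.
have sg (i j : 'I_n) : blade_sign K [set i] [set j] = (-1) ^+ (j <= i)%N.
  rewrite /blade_sign big_set1 big_mkcondr big_set1.
  by case: (j <= i)%N.
rewrite !sg; move: lm; rewrite -val_eqE /=.
by case: ltngtP => //= _ _; rewrite ?expr0 expr1 ?addrN ?addNr scale0r.
Qed.

End CliffordRing.

(* The norm of V_n; the choice among equivalent norms is immaterial, since it
   is only used to define boundedness. *)
Definition Vnorm (K : realType) (V : completeNormedModType K) n (v : Vn V n) : K :=
  \sum_A `|v A|.

Definition Vn_lmul (K : realType) (V : completeNormedModType K) n
  (a : clifford K n) (v : Vn V n) : Vn V n := blade_mul a v.

Definition Vn_rmul (K : realType) (V : completeNormedModType K) n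
  (v : Vn V n) (a : clifford K n) : Vn V n := blade_mulr v a.

Definition bounded_rlinear (K : realType) (V : completeNormedModType K) n
    (f : Vn V n -> Vn V n) : Prop :=
  [/\ forall u v, f (u + v) = f u + f v,
      forall v a, f (Vn_rmul v a) = Vn_rmul (f v) a &
      exists M : K, forall v, Vnorm (f v) <= M * Vnorm v].

(* B(V_n), with the pointwise addition, the real scaling and the composition *)
Section BoundedOperators.
Context {K : realType} {V : completeNormedModType K} {n : nat}.
Local Notation W := (Vn V n).

Definition bounded_rlinear_pred : {pred W -> W} :=
  fun f => `[< bounded_rlinear f >].

Record boundop := BoundOp {
  boundop_fun :> W -> W;
  boundopP : boundop_fun \in bounded_rlinear_pred }.

HB.instance Definition _ := [isSub for boundop_fun].
HB.instance Definition _ := [Choice of boundop by <:].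

Lemma Vnorm_ge0 (v : W) : 0 <= Vnorm v.
Proof. by apply: sumr_ge0. Qed.

Lemma Vnorm_comp (v : W) A : `|v A| <= Vnorm v.
Proof. by rewrite /Vnorm (bigD1 A) //= lerDl sumr_ge0. Qed.

Lemma VnormD (u v : W) : Vnorm (u + v) <= Vnorm u + Vnorm v.
Proof.
by rewrite /Vnorm -big_split; apply: ler_sum => A _; rewrite ffunE ler_normD.
Qed.

Lemma VnormZ k (v : W) : Vnorm (k *: v) = `|k| * Vnorm v.
Proof. by rewrite /Vnorm mulr_sumr; apply: eq_bigr => A _; rewrite ffunE normrZ. Qed.

Lemma Vnorm_lmul a (v : W) : Vnorm (Vn_lmul a v) <=
  (\sum_C \sum_A `|blade_sign K A (symdiff A C) * a A|) * Vnorm v.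
Proof.
rewrite mulr_suml; apply: ler_sum => C _; rewrite blade_mulE mulr_suml.
apply: le_trans (ler_norm_sum _ _ _) _; apply: ler_sum => A _.
by rewrite normrZ ler_wpM2l // Vnorm_comp.
Qed.

Lemma bounded_rlinear_submod : submod_closed bounded_rlinear_pred.
Proof.
split=> [|k f g /asboolP[fD fM [M fB]] /asboolP[gD gM [N gB]]]; apply/asboolP.
  split=> [u v|v a|]; first exact: (esym (addr0 (0 : W))).
    rewrite -[LHS]/(0 : W) -[X in Vn_rmul X]/(0 : W) -(scale0r (0 : W)).
    by rewrite /Vn_rmul blade_mulrZl !scale0r.
  exists 0 => v; rewrite -[X in Vnorm X]/(0 : W) mul0r -(scale0r (0 : W)).
  by rewrite VnormZ normr0 mul0r.
split=> [u v|v a|].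
- by rewrite !fctE fD gD scalerDr addrACA.
- by rewrite !fctE fM gM /Vn_rmul blade_mulrDl blade_mulrZl.
exists (`|k| * M + N) => v; rewrite !fctE; apply: le_trans (VnormD _ _) _.
by rewrite VnormZ mulrDl -mulrA lerD // ler_wpM2l.
Qed.

HB.instance Definition _ :=
  GRing.isSubmodClosed.Build K (W -> W) bounded_rlinear_pred bounded_rlinear_submod.
HB.instance Definition _ := [SubChoice_isSubLmodule of boundop by <:].

Lemma boundop_eq (S T : boundop) : (forall v, S v = T v) -> S = T.
Proof. by move=> ST; apply: val_inj; apply: funext. Qed.

Fact boundop_id_subproof : (fun v : W => v) \in bounded_rlinear_pred.
Proof. by apply/asboolP; split=> //; exists 1 => v; rewrite mul1r. Qed.

Definition boundop_id := BoundOp boundop_id_subproof.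

Fact boundop_comp_subproof (S T : boundop) :
  (fun v => S (T v)) \in bounded_rlinear_pred.
Proof.
have /asboolP[fD fM [M fB]] := boundopP S.
have /asboolP[gD gM [N gB]] := boundopP T.
apply/asboolP; split=> /= [u v|v a|]; rewrite ?gD ?fD ?gM ?fM //.
exists (`|M| * N) => v; apply: le_trans (fB _) _; rewrite -mulrA.
by apply: le_trans (ler_wpM2r (Vnorm_ge0 _) (ler_norm M)) _; rewrite ler_wpM2l.
Qed.

Definition boundop_comp S T := BoundOp (boundop_comp_subproof S T).

Fact boundop_compA : associative boundop_comp.
Proof. by move=> R S T; apply: boundop_eq. Qed.

Fact boundop_comp1l : left_id boundop_id boundop_comp.
Proof. by move=> T; apply: boundop_eq. Qed.

Fact boundop_comp1r : right_id boundop_id boundop_comp.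
Proof. by move=> T; apply: boundop_eq. Qed.

Fact boundop_compDl : left_distributive boundop_comp +%R.
Proof. by move=> R S T; apply: boundop_eq. Qed.

Fact boundop_compDr : right_distributive boundop_comp +%R.
Proof.
move=> R S T; apply: boundop_eq => v.
by have /asboolP[RD _ _] := boundopP R; apply: RD.
Qed.

HB.instance Definition _ := GRing.Zmodule_isPzRing.Build boundop
  boundop_compA boundop_comp1l boundop_comp1r boundop_compDl boundop_compDr.

(* Left multiplication by a Clifford number: the products aT and Ta of the
   two-sided module B(V_n) are a%:Op * T and T * a%:Op. *)
Fact clifford_op_subproof (a : clifford K n) :
  (Vn_lmul a : W -> W) \in bounded_rlinear_pred.
Proof.
apply/asboolP; split=> [u v|v b|]; first exact: blade_mulDr.
  exact: blade_mul_mulr.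
by eexists => v; apply: Vnorm_lmul.
Qed.

Definition clifford_op (a : clifford K n) : boundop :=
  BoundOp (clifford_op_subproof a).

End BoundedOperators.

Arguments boundop {K} V n.

Lemma boundop_mulE (K : realType) (V : completeNormedModType K) n
  (S T : boundop V n) v : (S * T) v = S (T v).
Proof. by []. Qed.

Notation "a %:Op" := (clifford_op a) (at level 1, format "a %:Op").

Record bounded_op (K : realType) (V : completeNormedModType K) := BoundedOp {
  bounded_op_fun :> {linear V -> V};
  bounded_opP : exists M : K, forall v, `|bounded_op_fun v| <= M * `|v| }.

Section ComponentwiseOp.
Context {K : realType} {V : completeNormedModType K} {n : nat}.

Fact componentwise_subproof (t : bounded_op V) :
  (fun v : Vn V n => [ffun A => t (v A)] : Vn V n) \in bounded_rlinear_pred.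
Proof.
case: t => t [M tM] /=; apply/asboolP; split=> [u v|v a|].
- by apply/ffunP => A; rewrite !ffunE linearD.
- apply/ffunP => A; rewrite ffunE /Vn_rmul !blade_mulrE linear_sum.
  by apply: eq_bigr => B _; rewrite linearZ ffunE.
exists M => v; rewrite /Vnorm mulr_sumr; apply: ler_sum => A _.
by rewrite ffunE.
Qed.

Definition componentwise (t : bounded_op V) : boundop V n :=
  BoundOp (componentwise_subproof t).

End ComponentwiseOp.

(* An element of BC^{0,1}(V_n), given by its components; the component of
   index 0 is T_0 and the one of index lift ord0 l is the coefficient of e_l. *)
Record paravector_op (K : realType) (V : completeNormedModType K) n := ParavectorOp {
  pop_comp : 'I_n.+1 -> bounded_op V;
  pop_commute : forall i j v,
    pop_comp i (pop_comp j v) = pop_comp j (pop_comp i v) }.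

Section ParavectorOp.
Context {K : realType} {V : completeNormedModType K} {n : nat}.
Variable T : paravector_op V n.

Definition op0 : boundop V n := componentwise (pop_comp T ord0).

Definition op_vec : boundop V n :=
  \sum_(l < n) (gen l)%:Op * componentwise (pop_comp T (lift ord0 l)).

Definition op : boundop V n := op0 + op_vec.

Definition opbar : boundop V n := op0 - op_vec.

Definition op_normsq : boundop V n := op * opbar.

End ParavectorOp.

Section Paravectors.
Context {K : realType} {n : nat}.
Implicit Types x : 'rV[K]_n.+1.

Definition para_re x : K := x 0 ord0.

Definition para_vec x : 'rV[K]_n := \row_l x 0 (lift ord0 l).

Definition enormsq m (x : 'rV[K]_m) : K := \sum_j x 0 j ^+ 2.

Definition enorm m (x : 'rV[K]_m) : K := Num.sqrt (enormsq x).

Definition vec (u : 'rV[K]_n) : clifford K n := \sum_l u 0 l *: gen l.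

Definition para x : clifford K n := (para_re x)%:A + vec (para_vec x).

Definition para_conj x : clifford K n := (para_re x)%:A - vec (para_vec x).

Definition para_sphere x : set 'rV[K]_n.+1 :=
  [set y | exists2 J : 'rV[K]_n, enorm J = 1 &
     para y = (para_re x)%:A + enorm (para_vec x) *: vec J].

End Paravectors.

(* The inverse of x, or 0 if x is not invertible. It is not available as x^-1
   on B(V_n), which is the trivial ring when V = 0. *)
Definition invertible (A : pzRingType) (x : A) : Prop :=
  exists y, x * y = 1 /\ y * x = 1.

Definition inverse (A : pzRingType) (x : A) : A :=
  xget 0 [set y | x * y = 1 /\ y * x = 1].

Section FFunctionalCalculus.
Context {K : realType} {V : completeNormedModType K} {n : nat}.
Variable T : paravector_op V n.
Local Notation half := (n.-1./2).
Implicit Types s : 'rV[K]_n.+1.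

Definition Fpencil s : boundop V n :=
  (para s ^+ 2)%:Op - (para s)%:Op * (op T + opbar T) + op T * opbar T.

Definition Fresolvent_set : set 'rV[K]_n.+1 := [set s | invertible (Fpencil s)].

Definition Q s : boundop V n := inverse (Fpencil s).

Definition SL s : boundop V n := ((para s)%:Op - opbar T) * Q s.

Definition SR s : boundop V n := Q s * ((para s)%:Op - opbar T).

Definition gamma : K := (-1) ^+ half * 2 ^+ n.-1 * (half`!)%:R ^+ 2.

Definition FL s : boundop V n :=
  gamma *: (((para s)%:Op - opbar T) * Q s ^+ n.+1./2).

Definition FR s : boundop V n :=
  gamma *: (Q s ^+ n.+1./2 * ((para s)%:Op - opbar T)).

End FFunctionalCalculus.

Arguments gamma : clear implicits.

(* The exponents below are only used for h >= 2 even and k <= M, where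
   2 * k <= h - 2, so that no natural subtraction is truncated. *)
Section Remainders.
Context {K : realType} {V : completeNormedModType K} {n : nat}.
Variables (T : paravector_op V n) (s p : 'rV[K]_n.+1).
Local Notation h := (n.-1./2).
Local Notation M := (h - 2)./2.
Local Notation R := (FR T s).
Local Notation L := (FL T p).
Local Notation t := (op T).
Local Notation s_ k := (para s ^+ k)%:Op.
Local Notation p_ k := (para p ^+ k)%:Op.
Local Notation us := (op_normsq T - 2 *: op0 T * (para s)%:Op).
Local Notation up := (op_normsq T - 2 *: op0 T * (para p)%:Op).

Definition A1 : boundop V n :=
  - (s_ h * R * t * L * p_ (h - 1)) - s_ (h - 1) * R * t * L * p_ h
  + s_ (h - 1) * R * t ^+ 2 * L * p_ (h - 1).

Definition B1 : boundop V n :=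
  s_ h * R * (\sum_(1 <= k < M.+1) 'C(M, k)%:R *: (up ^+ k * L * p_ (h - 2 * k)))
  - s_ h * R
    * (\sum_(1 <= k < M.+1) 'C(M, k)%:R *: (up ^+ k * t * L * p_ (h - 1 - 2 * k)))
  - s_ (h - 1) * R
    * (\sum_(1 <= k < M.+1) 'C(M, k)%:R *: (t * up ^+ k * L * p_ (h - 2 * k)))
  + s_ (h - 1) * R
    * (\sum_(1 <= k < M.+1) 'C(M, k)%:R *: (t * up ^+ k * t * L * p_ (h - 1 - 2 * k))).

Definition C1 : boundop V n :=
  (\sum_(1 <= k < M.+1) 'C(M, k)%:R *: (s_ (h - 2 * k) * R * us ^+ k))
    * (\sum_(1 <= k < M.+1) 'C(M, k)%:R *: (up ^+ k * L * p_ (h - 2 * k)))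
  - (\sum_(1 <= k < M.+1) 'C(M, k)%:R *: (s_ (h - 2 * k) * R * us ^+ k))
    * (\sum_(1 <= k < M.+1) 'C(M, k)%:R *: (up ^+ k * t * L * p_ (h - 1 - 2 * k)))
  - (\sum_(1 <= k < M.+1) 'C(M, k)%:R *: (s_ (h - 2 * k - 1) * R * t * us ^+ k))
    * (\sum_(1 <= k < M.+1) 'C(M, k)%:R *: (up ^+ k * L * p_ (h - 2 * k)))
  + (\sum_(1 <= k < M.+1) 'C(M, k)%:R *: (s_ (h - 2 * k - 1) * R * t * us ^+ k))
    * (\sum_(1 <= k < M.+1) 'C(M, k)%:R *: (up ^+ k * t * L * p_ (h - 1 - 2 * k)))
  + (\sum_(1 <= k < M.+1) 'C(M, k)%:R *: (s_ (h - 2 * k) * R * us ^+ k))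
    * L * p_ h
  - (\sum_(1 <= k < M.+1) 'C(M, k)%:R *: (s_ (h - 2 * k) * R * us ^+ k * t))
    * L * p_ (h - 1)
  - (\sum_(1 <= k < M.+1) 'C(M, k)%:R *: (s_ (h - 1 - 2 * k) * R * t * us ^+ k))
    * L * p_ h
  + (\sum_(1 <= k < M.+1) 'C(M, k)%:R *: (s_ (h - 1 - 2 * k) * R * t * us ^+ k * t))
    * L * p_ (h - 1).

End Remainders.

(* Main.v *)
From HB Require Import structures.
Require Import Defs.
From mathcomp Require Import all_boot all_order all_algebra all_field.
From mathcomp Require Import ring.
From mathcomp Require Import boolp classical_sets functions reals normedtype.

Set Implicit Arguments.
Unset Strict Implicit.
Unset Printing Implicit Defensive.

Import Order.TTheory GRing.Theory Num.Theory.

Local Open Scope ring_scope.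

(** Write h = 2 M + 2, a = s - Tb, b = p - Tb, P_s = s^2 - s (T + Tb) + T Tb, so
   that Qs inverts P_s, R = gamma Qs^(h+1) a and L = gamma b Qp^(h+1).

   T + Tb = 2 T_0 and T Tb = sum_l T_l^2 commute with the Clifford numbers,
   although T in general does not. Hence s commutes with P_s and Qs, and
     s a - a T = P_s,   b p - T b = P_p                                     (1)
   ([Fpencil_left], [Fpencil_right]).

   The identity is then obtained in three steps.

   - By (1), s R - R T = gamma Qs^h and L p - T L = gamma Qp^h. The terms
     A_1, B_1, C_1 and s^h R L p^h are the expanded product of
       sum_{k=0}^M C(M,k) s^(h-1-2k) (s R - R T) (|T|^2 - 2 T_0 s)^k
     and of its mirror image in p ([remainder_factor]). As
     P_s = s^2 + (|T|^2 - 2 T_0 s), the binomial formula turns the first factor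
     into gamma s Qs^h P_s^M = gamma s Qs^(M+2), and the second one into
     gamma Qp^(M+2) p ([left_factor], [right_factor], [remainder_sum]). So
     this block is gamma^2 s Qs^(M+2) Qp^(M+2) p; divided by gamma, it is
     gamma times the term of index i = M that the sum
     s (sum Qs^(h-i) Qp^(i+2)) p omits.

   - With that term restored, s p - s Tb - Tb p + Tb^2 = a b appears
     in every summand ([mulr_sandwich]), and the left-hand side is
     gamma Y with
       Y = sum_{i=0}^h Qs^(h+1-i) a b Qp^(i+1) + sum_{i=0}^{h-1} Qs^(h-i) Qp^(i+1).
     By (1) the map D : y |-> y p - s y sends each summand of Y to a difference
     and the sum telescopes: gamma (Y p - s Y) = R - L ([two_point_sum_eq]).

   - s + sbar = 2 s_0 and sbar s = |s|^2 are central, so that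
     Y (p^2 - 2 s_0 p + |s|^2) = (Y p - s Y) p - sbar (Y p - s Y)
     ([mulr_sphere_poly]). The quadratic factor lies in the commutative plane
     spanned by 1 and the vector part of p, and its norm there vanishes only
     for s in [p] ([sphere_poly_unit]). *)

(** * Identities in noncommutative rings *)

(** Pure bookkeeping: the four terms of the missing index and the four sums over
   the other indices are brought together, ready for [mulr_sandwich]. *)
Lemma regroup_sandwiches (U : zmodType) (F G A B C D S e f g k : U) :
  F + G + (- B - C + D + S + e - f - g + k) + A =
  F + (A - B - C + D + (e - f - g + k)) + G + S.
Proof. by rewrite !addrA [LHS](ACl (1*11*3*4*5*7*8*9*10*2*6)). Qed.

Section Ring.
Context {A : pzRingType}.

Lemma mulrBB (a b c d : A) : a * c - a * d - b * c + b * d = (a - b) * (c - d).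
Proof. by rewrite mulrBl !mulrBr opprD opprK addrA. Qed.

(** This and its mirror image are factorizations of the pencil of T at x in
   which x stands outside: x and tb need not commute, so the two orders of the
   factors differ. *)
Lemma pencil_left (x t tb : A) : GRing.comm t tb ->
  x * (x - tb) - (x - tb) * t = x ^+ 2 - x * (t + tb) + t * tb.
Proof.
move=> ttb; rewrite mulrBr mulrBl mulrDr expr2 ttb.
by rewrite opprB opprD !addrA [LHS]addrAC; congr (_ + _); apply: addrAC.
Qed.

Lemma pencil_right (x t tb : A) :
  (x - tb) * x - t * (x - tb) = x ^+ 2 - (t + tb) * x + t * tb.
Proof.
rewrite mulrBr mulrBl mulrDl expr2.
by rewrite opprB opprD !addrA [LHS]addrAC; congr (_ + _); apply: addrAC.
Qed.

(** The left-hand side is the shape in which telescoping works; the right-hand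
   side is the shape in which these terms occur once x and y are moved to the
   outside of the powers that they commute with. *)
Lemma mulr_sandwich (x y tb l r : A) : GRing.comm x l -> GRing.comm y r ->
  l * (x - tb) * (y - tb) * r =
  x * l * r * y - x * l * tb * r - l * tb * r * y + l * tb ^+ 2 * r.
Proof.
move=> xl yr; rewrite -(mulrA l) -mulrBB mulrDr !mulrBr mulrDl !mulrBl.
by rewrite -!(mulrA _ r y) -yr xl expr2 !mulrA.
Qed.

Lemma comm_inverse (x y z : A) :
  GRing.comm x y -> y * z = 1 -> z * y = 1 -> GRing.comm x z.
Proof.
move=> xy yz zy; rewrite /GRing.comm -[LHS]mul1r -zy -mulrA (mulrA y) -xy.
by rewrite -mulrA yz mulr1.
Qed.

(** The mixed products cancel in pairs: the reason why the square of a Clifford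
   vector is a scalar, used both for vectors and for vector operators. *)
Lemma sqr_sum_anticomm m (x : 'I_m -> A) :
  (forall i j, i != j -> x i * x j + x j * x i = 0) ->
  (\sum_i x i) ^+ 2 = \sum_i x i ^+ 2.
Proof.
elim: m x => [|m IH] x anti; first by rewrite !big_ord0 expr0n.
rewrite !big_ord_recr /= -IH => [|i j ij]; last first.
  by apply: anti; apply: contra_neq ij => /(congr1 val) /= ijE; apply: val_inj.
rewrite !expr2 mulrDl !mulrDr addrA -(addrA (_ * _)); congr (_ + _).
rewrite -[RHS]addr0; congr (_ + _).
rewrite mulr_suml mulr_sumr -big_split big1 //= => i _.
by apply: anti; rewrite -val_eqE /= ltn_eqF.
Qed.

Section TwoPointSum.
Variables (s p t a b qs qp : A).
Hypotheses (sqs : GRing.comm s qs) (pqp : GRing.comm p qp).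
Hypothesis as_inv : qs * (s * a - a * t) = 1.
Hypothesis bp_inv : (b * p - t * b) * qp = 1.
Hypothesis ba : b - a = p - s.

Let D y := y * p - s * y.

Let DD x y : D (x + y) = D x + D y.
Proof. by rewrite /D mulrDl mulrDr opprD addrACA. Qed.

Let Dqs y : D (qs * y) = qs * D y.
Proof. by rewrite /D mulrBr !mulrA sqs. Qed.

(** As b p qp = t b qp + 1 and qs s a = qs a t + 1, both products contain
   qs a t b qp^(k+1), which cancels. *)
Let D_sandwich k : D (qs * a * b * qp ^+ k.+1) = qs * a * qp ^+ k - b * qp ^+ k.+1.
Proof.
have e1 : qs * s * a = qs * a * t + 1.
  by rewrite -as_inv mulrBr !mulrA addrC subrK.
have e2 : b * p * qp = t * b * qp + 1 by rewrite -bp_inv mulrBl addrC subrK.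
have pX j : qp ^+ j * p = p * qp ^+ j by apply/commr_sym/commrX.
rewrite /D; have -> : qs * a * b * qp ^+ k.+1 * p = qs * a * (b * p * qp) * qp ^+ k.
  by rewrite -mulrA pX exprS !mulrA.
have -> : s * (qs * a * b * qp ^+ k.+1) = (qs * s * a) * b * qp ^+ k.+1.
  by rewrite !mulrA sqs.
rewrite e1 e2 mulrDr mulr1 !mulrDl mul1r exprS !mulrA.
by rewrite (addrC (_ * t * _ * _ * _)) opprD addrA addrK.
Qed.

(** A solution y of y p - s y = qs^(h+1) a - b qp^(h+1), a noncommutative
   analogue of the divided difference of two powers: the first sum alone leaves
   differences in a and b that the second one, through b - a = p - s, turns
   into a telescoping sum. *)
Definition two_point_sum h :=
  \sum_(0 <= i < h.+1) qs ^+ (h.+1 - i) * a * b * qp ^+ i.+1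
  + \sum_(0 <= i < h) qs ^+ (h - i) * qp ^+ i.+1.

Lemma two_point_sumS h : two_point_sum h.+1 =
  qs * two_point_sum h + qs * a * b * qp ^+ h.+2 + qs * qp ^+ h.+1.
Proof.
rewrite /two_point_sum big_nat_recr //= [X in _ + X]big_nat_recr //=.
rewrite !subSnn !expr1 mulrDr addrACA !addrA; congr (_ + _ + _ + _).
  rewrite mulr_sumr; apply: eq_big_nat => i /andP[_ ih].
  by rewrite !mulrA -exprS subSn // ltnW.
rewrite mulr_sumr; apply: eq_big_nat => i /andP[_ ih].
by rewrite !mulrA -exprS subSn // ltnW.
Qed.

Lemma two_point_sum_eq h :
  two_point_sum h * p - s * two_point_sum h =
  qs ^+ h.+1 * a - b * qp ^+ h.+1.
Proof.
rewrite -/(D _); elim: h => [|h IH].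
  rewrite /two_point_sum big_nat1 big_geq // addr0 subn0 expr1.
  by rewrite (D_sandwich 0) expr0 mulr1.
rewrite two_point_sumS !DD Dqs IH D_sandwich Dqs.
have -> : D (qp ^+ h.+1) = b * qp ^+ h.+1 - a * qp ^+ h.+1.
  by rewrite -mulrBl ba /D mulrBl; congr (_ - _); apply/commr_sym/commrX.
by rewrite !mulrBr !mulrA -exprS addrAC !subrKA.
Qed.

End TwoPointSum.

(** When its coefficients commute with Y, right multiplication of Y by the
   quadratic polynomial is the composite of the maps y |-> y p - s y and
   y |-> y p - sb y. *)
Lemma mulr_sphere_poly (Y s sb p : A) :
  GRing.comm Y (s + sb) -> GRing.comm Y (sb * s) ->
  Y * (p ^+ 2 - (s + sb) * p + sb * s) =
  (Y * p - s * Y) * p - sb * (Y * p - s * Y).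
Proof.
move=> Yc Yn; rewrite mulrDr Yn mulrBr mulrA Yc.
rewrite !mulrBl mulrBr mulrA !mulrDl expr2 !mulrA.
by rewrite opprD opprB !addrA [LHS]addrAC.
Qed.

End Ring.

(** * The remainder terms as a product *)

Section Remainder.
Context {A : pzRingType}.
Variables (t L P P' u v X1 X2 Z1 Z2 : A).

(** The four groups of terms are the shapes of A_1, B_1, C_1 and s^h R L p^h, with
   u = s^h R, v = s^(h-1) R, P = p^h, P' = p^(h-1), and with X1, X2, Z1, Z2 the
   four sums over 1 <= k <= M. The first and the last group form the product
   of the terms k = 0, the second one is u - v t times Z1 - Z2, and the third one
   is X1 - X2 times the whole right factor. *)
Lemma remainder_factor :
  - (u * t * L * P') - v * t * L * P + v * t ^+ 2 * L * P'
  + (u * Z1 - u * Z2 - v * (t * Z1) + v * (t * Z2))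
  + (X1 * Z1 - X1 * Z2 - X2 * Z1 + X2 * Z2
     + X1 * L * P - X1 * t * L * P' - X2 * L * P + X2 * t * L * P')
  + u * L * P
  = (u - v * t + (X1 - X2)) * (L * P - t * L * P' + (Z1 - Z2)).
Proof.
have mulDD (x X z Z : A) : (x + X) * (z + Z) = x * z + x * Z + (X * Z + X * z).
  by rewrite mulrDl !mulrDr [X * z + _]addrC.
rewrite mulDD -!mulrBB !mulrA -!(mulrA _ t t) -!expr2.
rewrite addrAC [X in X + _]addrAC.
congr (_ + _ + _); last by rewrite !addrA.
by rewrite addrC !addrA.
Qed.

End Remainder.

Section BinomialFactor.
Context {A : pzRingType}.
Variables (M : nat) (t : A).

(** The terms in front of the sums are those of index k = 0. For every k the
   two terms combine into s^(2(M-k)+1) (s R - R t) us^k, and the powers of s^2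
   can cross s R - R t, which leaves the binomial expansion of (s^2 + us)^M. *)
Lemma left_factor (s R us : A) :
  GRing.comm s us -> GRing.comm s (s * R - R * t) ->
  s ^+ M.*2.+2 * R - s ^+ M.*2.+1 * R * t
  + (\sum_(1 <= k < M.+1) (s ^+ (M.*2.+2 - 2 * k) * R * us ^+ k) *+ 'C(M, k)
     - \sum_(1 <= k < M.+1) (s ^+ (M.*2.+1 - 2 * k) * R * t * us ^+ k) *+ 'C(M, k))
  = s * (s * R - R * t) * (s ^+ 2 + us) ^+ M.
Proof.
move=> s_us; set e := s * R - R * t => s_e.
have sXe m : s ^+ m * e = e * s ^+ m by apply/commr_sym/commrX/commr_sym.
rewrite exprDn_comm; last exact/commr_sym/commrX/commr_sym.
rewrite -(big_mkord xpredT (fun k => (s ^+ 2) ^+ (M - k) * us ^+ k *+ 'C(M, k))).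
rewrite mulr_sumr [RHS]big_ltn // bin0 mulr1n expr0 mulr1 subn0 -sumrB; congr (_ + _).
  by rewrite -[RHS]mulrA -exprM mul2n -sXe mulrA -exprS /e mulrBr !mulrA -exprSr.
apply: eq_big_nat => k /andP[_ kM].
have k2 : (k.*2 <= M.*2)%N by rewrite leq_double.
rewrite -mulrnBl mulrnAr mul2n !subSn ?(leqW k2) //; congr (_ *+ _).
rewrite mulrA -(mulrA s) -exprM mulnBr !mul2n -sXe (mulrA s) -exprS.
by rewrite /e mulrBr !mulrA -exprSr mulrBl.
Qed.

Lemma right_factor (p L up : A) :
  GRing.comm p up -> GRing.comm p (L * p - t * L) ->
  L * p ^+ M.*2.+2 - t * L * p ^+ M.*2.+1
  + (\sum_(1 <= k < M.+1) (up ^+ k * L * p ^+ (M.*2.+2 - 2 * k)) *+ 'C(M, k)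
     - \sum_(1 <= k < M.+1) (up ^+ k * t * L * p ^+ (M.*2.+1 - 2 * k)) *+ 'C(M, k))
  = (p ^+ 2 + up) ^+ M * (L * p - t * L) * p.
Proof.
move=> p_up; set e := L * p - t * L => p_e.
have pXe m : p ^+ m * e = e * p ^+ m by apply/commr_sym/commrX/commr_sym.
have pup : GRing.comm up (p ^+ 2) by apply/commrX/commr_sym.
rewrite addrC exprDn_comm; last exact: commr_sym.
rewrite -(big_mkord xpredT (fun k => (p ^+ 2) ^+ (M - k) * up ^+ k *+ 'C(M, k))).
rewrite !mulr_suml [RHS]big_ltn // bin0 mulr1n expr0 mulr1 subn0 -sumrB addrC.
congr (_ + _).
  by rewrite -exprM mul2n pXe -[RHS]mulrA -exprSr /e mulrBl -!mulrA -exprS.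
apply: eq_big_nat => k /andP[_ kM].
have k2 : (k.*2 <= M.*2)%N by rewrite leq_double.
rewrite -mulrnBl !mulrnAl mul2n !subSn ?(leqW k2) //; congr (_ *+ _).
rewrite -exprM mulnBr !mul2n -(commrX _ (commr_sym (commrX _ p_up))) -!mulrA.
rewrite (mulrA _ e) pXe -mulrA -exprSr.
by rewrite /e -mulrBr mulrBl -!mulrA -exprS.
Qed.

End BinomialFactor.

(** * Clifford numbers and scalars acting on operators *)

Section OperatorRing.
Context {K : realType} {V : completeNormedModType K} {n : nat}.
Implicit Types (S T : boundop V n) (a b : clifford K n) (k : K).

Lemma clifford_op_is_zmod_morphism :
  zmod_morphism (@clifford_op K V n).
Proof.
move=> a b; apply: boundop_eq => v.
have -> : ((a%:Op : boundop V n) - b%:Op) v = Vn_lmul a v - Vn_lmul b v by [].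
by rewrite /= /Vn_lmul blade_mulDl -scaleN1r blade_mulZl scaleN1r.
Qed.

Lemma clifford_op_is_monoid_morphism : monoid_morphism (@clifford_op K V n).
Proof.
split=> [|a b]; apply: boundop_eq => v; first exact: blade_mul1.
exact: blade_mulA.
Qed.

HB.instance Definition _ := GRing.isZmodMorphism.Build _ _ (@clifford_op K V n)
  clifford_op_is_zmod_morphism.
HB.instance Definition _ := GRing.isMonoidMorphism.Build _ _ (@clifford_op K V n)
  clifford_op_is_monoid_morphism.

Lemma clifford_opX a m : (a ^+ m)%:Op = a%:Op ^+ m :> boundop V n.
Proof. exact: rmorphXn. Qed.

Lemma clifford_opZ k a : (k *: a)%:Op = k *: (a%:Op) :> boundop V n.
Proof. by apply: boundop_eq => v; apply: blade_mulZl. Qed.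

Lemma boundop_scalerAl k S T : k *: (S * T) = k *: S * T.
Proof. exact: boundop_eq. Qed.

Lemma Vn_rmul_scalar (v : Vn V n) k : Vn_rmul v k%:A = k *: v.
Proof.
apply/ffunP => C; rewrite /Vn_rmul blade_mulrE (bigD1 C) //= big1 => [|B BC].
  have -> : symdiff C C = finset.set0 by apply/setP => i; rewrite in_symdiff inE addbb.
  by rewrite !ffunE eqxx blade_sign0r mul1r [k *: _]mulr1 addr0.
rewrite !ffunE symdiff_eqE (symdiffC B finset.set0) symdiff0 eq_sym (negPf BC).
by rewrite scaler0 mulr0 scale0r.
Qed.

(** Homogeneity of S over the reals is part of its linearity over the Clifford
   numbers, as real scalars act on the right too. *)
Lemma boundop_scalerAr k S T : k *: (S * T) = S * (k *: T).
Proof.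
apply: boundop_eq => v.
have /asboolP[_ SM _] := boundopP S.
by rewrite boundop_mulE /= -[RHS]/(S (k *: T v)) -Vn_rmul_scalar SM Vn_rmul_scalar.
Qed.

Lemma boundop_scaleM k S T : (k *: S) * (k *: T) = k ^+ 2 *: (S * T).
Proof. by rewrite -boundop_scalerAl -boundop_scalerAr scalerA. Qed.

Lemma boundop_commZ k S T : GRing.comm S T -> GRing.comm S (k *: T).
Proof. by move=> ST; rewrite /GRing.comm -boundop_scalerAr ST boundop_scalerAl. Qed.

Lemma componentwise_comm_clifford (t : bounded_op V) a :
  GRing.comm (a%:Op) (componentwise t : boundop V n).
Proof.
apply: boundop_eq => v; apply/ffunP => C; rewrite !boundop_mulE /= /Vn_lmul.
rewrite blade_mulE [RHS]ffunE blade_mulE linear_sum.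
by apply: eq_bigr => B _; rewrite linearZ ffunE.
Qed.

Lemma scalar_op_comm S k : GRing.comm S (k%:A%:Op).
Proof. by rewrite clifford_opZ rmorph1; apply/boundop_commZ/commr1. Qed.

End OperatorRing.

(** * Paravector operators with commuting components *)

Section ParavectorOperators.
Context {K : realType} {V : completeNormedModType K} {n : nat}.
Variable T : paravector_op V n.

Local Notation cmp i := (componentwise (pop_comp T i) : boundop V n).

Lemma comp_comm i j : GRing.comm (cmp i) (cmp j).
Proof.
apply: boundop_eq => v; apply/ffunP => C.
by rewrite !boundop_mulE /= !ffunE pop_commute.
Qed.

Lemma op0_comm_op_vec : GRing.comm (op0 T) (op_vec T).
Proof.
apply: commr_sum => l _; apply: commrM; last exact: comp_comm.
exact/commr_sym/componentwise_comm_clifford.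
Qed.

Lemma op_vec_sqr :
  op_vec T ^+ 2 = - \sum_(l < n) cmp (lift ord0 l) ^+ 2.
Proof.
have mulE l m : (gen l)%:Op * cmp (lift ord0 l) * ((gen m)%:Op * cmp (lift ord0 m))
    = (gen l * gen m)%:Op * (cmp (lift ord0 l) * cmp (lift ord0 m)).
  rewrite rmorphM -!mulrA; congr (_ * _); rewrite !mulrA; congr (_ * _).
  exact/commr_sym/componentwise_comm_clifford.
rewrite /op_vec sqr_sum_anticomm -?sumrN => [|l m lm].
  by apply: eq_bigr => l _; rewrite expr2 mulE gen_sqr rmorphN1 mulN1r expr2.
rewrite !mulE (comp_comm (lift ord0 m)) -mulrDl -rmorphD gen_anticomm //.
by rewrite rmorph0 mul0r.
Qed.

Lemma op_comm_opbar : GRing.comm (op T) (opbar T).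
Proof.
rewrite /GRing.comm /op /opbar !mulrDl !mulrDr !mulrN !mulNr.
by rewrite op0_comm_op_vec !addrA addrNK addrK.
Qed.

Lemma opDopbar : op T + opbar T = 2 *: op0 T.
Proof. by rewrite /op /opbar addrACA subrr addr0 scaler_nat mulr2n. Qed.

(** This expression in components shows that T Tb commutes with the Clifford
   numbers, which its two factors in general do not. *)
Lemma op_normsqE : op_normsq T =
  op0 T ^+ 2 + \sum_(l < n) cmp (lift ord0 l) ^+ 2.
Proof.
rewrite /op_normsq /op /opbar mulrDl !mulrBr -op0_comm_op_vec addrA subrK.
by rewrite -!expr2 op_vec_sqr opprK.
Qed.

Variable a : clifford K n.
Local Notation c := (a%:Op : boundop V n).

Lemma op_normsq_comm : GRing.comm c (op_normsq T).
Proof.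
rewrite op_normsqE; apply: commrD.
  exact/commrX/componentwise_comm_clifford.
by apply: commr_sum => l _; apply/commrX/componentwise_comm_clifford.
Qed.

Lemma op0_comm : GRing.comm c (op0 T).
Proof. exact: componentwise_comm_clifford. Qed.

End ParavectorOperators.

(** * Paravectors and spheres *)

Section Sphere.
Context {K : realType} {n : nat}.
Implicit Types (u : 'rV[K]_n) (x s p : 'rV[K]_n.+1).

Lemma vec_sqr u : vec u ^+ 2 = - (enormsq u)%:A.
Proof.
rewrite /vec sqr_sum_anticomm => [|l m lm]; last first.
  by rewrite -!scalerAl -!scalerAr !scalerA mulrC -scalerDr gen_anticomm ?scaler0.
rewrite /enormsq scaler_suml -sumrN; apply: eq_bigr => l _.
by rewrite exprZn (expr2 (gen l)) gen_sqr scalerN.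
Qed.

Lemma enormsq_para x :
  enormsq x = para_re x ^+ 2 + enormsq (para_vec x).
Proof.
rewrite /enormsq big_ord_recl; congr (_ + _); apply: eq_bigr => l _.
by rewrite mxE.
Qed.

Lemma enormsq_ge0 m (x : 'rV[K]_m) : 0 <= enormsq x.
Proof. by apply: sumr_ge0 => i _; apply: sqr_ge0. Qed.

Lemma para_conj_mul x : para_conj x * para x = (enormsq x)%:A.
Proof.
rewrite enormsq_para scalerDl /para /para_conj.
set r := _%:A.
have rv : GRing.comm r (vec (para_vec x)).
  by rewrite /GRing.comm -scalerAl mul1r -scalerAr mulr1.
rewrite mulrBl !mulrDr rv opprD addrA addrK -[X in _ - X]expr2.
rewrite vec_sqr opprK.
by congr (_ + _); rewrite /r -scalerAl mul1r scalerA.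
Qed.

Lemma paraDconj x : para x + para_conj x = (2 * para_re x)%:A.
Proof. by rewrite /para /para_conj addrACA subrr addr0 -scalerDl mulr_natl mulr2n. Qed.

Lemma para_sqr x :
  para x ^+ 2 = (2 * para_re x) *: para x - (enormsq x)%:A.
Proof.
by rewrite -para_conj_mul -mulr_algl -paraDconj mulrDl addrK expr2.
Qed.

(** If p is real, then so is s, and any unit vector J will do; this is where
   n > 0 is needed. *)
Lemma para_sphereP s p : (0 < n)%N ->
  para_re s = para_re p -> enormsq (para_vec s) = enormsq (para_vec p) ->
  para_sphere p s.
Proof.
move=> n0 e0 ev; rewrite /para_sphere /=.
pose r := enorm (para_vec p).
have [r0|r0] := eqVneq r 0.
  exists (delta_mx 0 (Ordinal n0)).
    rewrite /enorm /enormsq (bigD1 (Ordinal n0)) //= big1 => [|i i0].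
      by rewrite mxE !eqxx expr1n addr0 sqrtr1.
    by rewrite mxE (negPf i0) andbF expr0n.
  rewrite -/r r0 scale0r addr0 /para e0 -[RHS]addr0; congr (_ + _).
  have : enormsq (para_vec s) = 0.
    by apply/eqP; rewrite ev eq_le enormsq_ge0 andbT -sqrtr_eq0; apply/eqP.
  move/eqP; rewrite psumr_eq0 => [/allP z|i _]; last exact: sqr_ge0.
  apply: big1 => l _; have := z l; rewrite mem_index_enum => /(_ isT).
  by rewrite sqrf_eq0 => /eqP ->; rewrite scale0r.
exists (r^-1 *: para_vec s).
  rewrite /enorm /enormsq; under eq_bigr => i _ do rewrite mxE exprMn.
  rewrite -mulr_sumr -/(enormsq _) ev -(sqr_sqrtr (enormsq_ge0 (para_vec p))).
  by rewrite -/(enorm _) -/r -exprMn mulVf // expr1n sqrtr1.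
rewrite /para e0; congr (_ + _); rewrite /vec scaler_sumr; apply: eq_bigr => l _.
by rewrite scalerA [in RHS]mxE -/r mulrA mulfV // mul1r.
Qed.

Lemma sphere_polyE s p :
  para p ^+ 2 - (2 * para_re s) *: para p + (enormsq s)%:A
  = para p ^+ 2 - (para s + para_conj s) * para p + para_conj s * para s.
Proof. by rewrite paraDconj para_conj_mul mulr_algl. Qed.

(** By the quadratic equation of p, the element is al + be v with v the vector
   part of p, and (al + be v) (al - be v) is the real number
   N = al^2 + be^2 |v|^2. If N = 0, then al = 0 and either be = 0, in which case
   s and p have the same real part and the same norm, or v = 0, in which case
   al = |s - p|^2 and s = p. *)
Lemma sphere_poly_unit s p : (0 < n)%N -> ~ para_sphere p s ->
  para p ^+ 2 - (2 * para_re s) *: para p + (enormsq s)%:A \is a GRing.unit.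
Proof.
move=> n0 sp.
pose al := 2 * (para_re p - para_re s) * para_re p + enormsq s - enormsq p.
pose be := 2 * (para_re p - para_re s).
pose N := al ^+ 2 + be ^+ 2 * enormsq (para_vec p).
have -> : para p ^+ 2 - (2 * para_re s) *: para p + (enormsq s)%:A
          = al%:A + be *: vec (para_vec p).
  rewrite para_sqr [_ - _ - _]addrAC -scalerBl -mulrBr -/be /para.
  rewrite /al -/be scalerBl !scalerDl scalerDr scalerA.
  by rewrite addrAC [RHS]addrAC; congr (_ - _); apply: addrAC.
have N0 : N != 0.
  apply/eqP => NE; apply: sp.
  have : (al == 0) && (be ^+ 2 * enormsq (para_vec p) == 0).
    rewrite -sqrf_eq0 -paddr_eq0 ?sqr_ge0 ?(mulr_ge0 (sqr_ge0 _) (enormsq_ge0 _)) //.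
    exact/eqP.
  rewrite mulf_eq0 sqrf_eq0 => /andP[al0 /orP[be0|pv0]].
    have e0 : para_re s = para_re p.
      by apply/eqP; move: be0; rewrite /be mulf_eq0 pnatr_eq0 /= subr_eq0 eq_sym.
    apply: para_sphereP => //.
    move/eqP: al0; rewrite /al e0 subrr mulr0 mul0r add0r !enormsq_para e0.
    by rewrite opprD addrACA subrr add0r => /subr0_eq.
  move/eqP: al0; rewrite /al !enormsq_para (eqP pv0) addr0 => al0.
  have /eqP : (para_re p - para_re s) ^+ 2 + enormsq (para_vec s) = 0.
    rewrite -[RHS]al0; ring.
  rewrite paddr_eq0 ?sqr_ge0 ?enormsq_ge0 // sqrf_eq0 subr_eq0 => /andP[e0 sv0].
  by apply: para_sphereP => //; [rewrite (eqP e0) | rewrite (eqP pv0) (eqP sv0)].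
apply/unitrP; exists (N^-1 *: (al%:A - be *: vec (para_vec p))).
set v := vec _.
have vM : (be *: v) ^+ 2 = - (be ^+ 2 * enormsq (para_vec p))%:A.
  by rewrite exprZn vec_sqr scalerN scalerA.
have av : GRing.comm (al%:A) (be *: v).
  by rewrite /GRing.comm -scalerAl mul1r -scalerAr mulr1.
have alM : al%:A * al%:A = (al ^+ 2)%:A :> clifford K n.
  by rewrite -scalerAl mul1r scalerA.
split.
  rewrite -scalerAl mulrDr !mulrBl alM -av addrA subrK -expr2 vM opprK -scalerDl.
  by rewrite scalerA mulVf // scale1r.
rewrite -scalerAr mulrBr !mulrDl alM -av -expr2 vM opprD addrA addrK opprK.
by rewrite -scalerDl scalerA mulVf // scale1r.
Qed.

End Sphere.

(** * The resolvents of T *)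

Section Resolvent.
Context {K : realType} {V : completeNormedModType K} {n : nat}.
Variable T : paravector_op V n.
Implicit Types s p : 'rV[K]_n.+1.

(** The part of the pencil that remains once s^2 is removed; its powers are the
   ones in the binomial sums. *)
Definition Fpencil_tail s : boundop V n := op_normsq T - 2 *: op0 T * (para s)%:Op.

Lemma FpencilE s : Fpencil T s = (para s)%:Op ^+ 2 + Fpencil_tail s.
Proof.
rewrite /Fpencil clifford_opX opDopbar -/(op_normsq T) addrAC addrA; congr (_ - _).
exact/boundop_commZ/op0_comm.
Qed.

Lemma comm_Fpencil_tail s : GRing.comm (para s)%:Op (Fpencil_tail s).
Proof.
apply: commrB; first exact: op_normsq_comm.
by apply: commrM => //; apply/boundop_commZ/op0_comm.
Qed.

Lemma comm_Fpencil s : GRing.comm (para s)%:Op (Fpencil T s).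
Proof. by rewrite FpencilE; apply: commrD; [apply: commrX | apply: comm_Fpencil_tail]. Qed.

Lemma Fpencil_left s :
  (para s)%:Op * ((para s)%:Op - opbar T) - ((para s)%:Op - opbar T) * op T
  = Fpencil T s.
Proof. by rewrite /Fpencil clifford_opX pencil_left //; apply: op_comm_opbar. Qed.

Lemma Fpencil_right s :
  ((para s)%:Op - opbar T) * (para s)%:Op - op T * ((para s)%:Op - opbar T)
  = Fpencil T s.
Proof.
rewrite /Fpencil clifford_opX pencil_right opDopbar; congr (_ - _ + _).
exact/commr_sym/boundop_commZ/op0_comm.
Qed.

Section AtPoint.
Variable s : 'rV[K]_n.+1.
Hypothesis s_res : Fresolvent_set T s.

Lemma Q_inv : Fpencil T s * Q T s = 1 /\ Q T s * Fpencil T s = 1.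
Proof. by case: s_res => y y_inv; rewrite /Q /inverse; case: xgetP => // /(_ y). Qed.

Lemma Q_comm : GRing.comm (para s)%:Op (Q T s).
Proof. by case: Q_inv; apply: comm_inverse; apply: comm_Fpencil. Qed.

Lemma Q_exp_cancelr i j :
  Q T s ^+ (i + j) * Fpencil T s ^+ j = Q T s ^+ i.
Proof.
case: Q_inv => PQ QP; elim: j => [|j IH]; first by rewrite addn0 mulr1.
by rewrite addnS exprSr exprS -!mulrA (mulrA (Q T s)) QP mul1r.
Qed.

Lemma Q_exp_cancell i j :
  Fpencil T s ^+ j * Q T s ^+ (j + i) = Q T s ^+ i.
Proof.
case: Q_inv => PQ QP; elim: j => [|j IH]; first by rewrite mul1r.
by rewrite addSn exprSr exprS -!mulrA (mulrA (Fpencil T s)) PQ mul1r.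
Qed.

(** The exponent (n+1)/2 drops by one, because s a - a T is the pencil that
   the outermost Q inverts. *)
Lemma FR_resolvent_eq : (0 < n)%N ->
  (para s)%:Op * FR T s - FR T s * op T = gamma K n *: Q T s ^+ n.-1./2.
Proof.
move=> n_gt0; have nE : n.+1./2 = n.-1./2.+1 by rewrite -{1}(prednK n_gt0).
rewrite /FR nE -boundop_scalerAr -boundop_scalerAl -scalerBr; congr (_ *: _).
rewrite mulrA (commrX _ Q_comm) -!mulrA -mulrBr Fpencil_left.
by have := Q_exp_cancelr n.-1./2 1; rewrite addn1 expr1.
Qed.

Lemma FL_resolvent_eq : (0 < n)%N ->
  FL T s * (para s)%:Op - op T * FL T s = gamma K n *: Q T s ^+ n.-1./2.
Proof.
move=> n_gt0; have nE : n.+1./2 = n.-1./2.+1 by rewrite -{1}(prednK n_gt0).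
rewrite /FL nE -boundop_scalerAr -boundop_scalerAl -scalerBr; congr (_ *: _).
rewrite -mulrA -(commrX _ Q_comm) !mulrA -mulrBl Fpencil_right.
by have := Q_exp_cancell n.-1./2 1; rewrite add1n expr1.
Qed.

End AtPoint.

Section Remainder.
Variables (s p : 'rV[K]_n.+1) (M : nat).
Hypotheses (s_res : Fresolvent_set T s) (p_res : Fresolvent_set T p).
Hypothesis hM : n.-1./2 = M.*2.+2.

(** Each factor given by [remainder_factor] is Q^(2M+2) times the M-th power of
   the pencil, hence Q^(M+2). *)
Lemma remainder_sum :
  A1 T s p + B1 T s p + C1 T s p
  + (para s ^+ n.-1./2)%:Op * FR T s * FL T p * (para p ^+ n.-1./2)%:Op
  = gamma K n ^+ 2 *:
    ((para s)%:Op * Q T s ^+ M.+2 * Q T p ^+ M.+2 * (para p)%:Op).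
Proof.
have n_gt0 : (0 < n)%N by case: (n) hM.
have M'E : (n.-1./2 - 2)./2 = M by rewrite hM !subSS subn0 doubleK.
have h1 : (n.-1./2 - 1)%N = M.*2.+1 by rewrite hM subn1.
set cs := (para s)%:Op; set cp := (para p)%:Op.
set R := FR T s; set L := FL T p; set t := op T.
set us := Fpencil_tail s; set up := Fpencil_tail p.
pose X1 := \sum_(1 <= k < M.+1) (cs ^+ (M.*2.+2 - 2 * k) * R * us ^+ k) *+ 'C(M, k).
pose X2 := \sum_(1 <= k < M.+1) (cs ^+ (M.*2.+1 - 2 * k) * R * t * us ^+ k) *+ 'C(M, k).
pose Z1 := \sum_(1 <= k < M.+1) (up ^+ k * L * cp ^+ (M.*2.+2 - 2 * k)) *+ 'C(M, k).
pose Z2 := \sum_(1 <= k < M.+1) (up ^+ k * t * L * cp ^+ (M.*2.+1 - 2 * k)) *+ 'C(M, k).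
have sR : GRing.comm cs (cs * R - R * t).
  by rewrite FR_resolvent_eq //; apply/boundop_commZ/commrX/Q_comm.
have pL : GRing.comm cp (L * cp - t * L).
  by rewrite FL_resolvent_eq //; apply/boundop_commZ/commrX/Q_comm.
have X12 := left_factor M (comm_Fpencil_tail s) sR.
have Z12 := right_factor M (comm_Fpencil_tail p) pL.
rewrite -!FpencilE in X12 Z12; rewrite FR_resolvent_eq // hM in X12; rewrite FL_resolvent_eq // hM in Z12.
have e2 : M.*2.+2 = (M.+2 + M)%N by rewrite -addnn !addSn.
have QX : cs * (gamma K n *: Q T s ^+ M.*2.+2) * Fpencil T s ^+ M
          = gamma K n *: (cs * Q T s ^+ M.+2).
  by rewrite -mulrA -boundop_scalerAl -boundop_scalerAr e2 Q_exp_cancelr.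
have QZ : Fpencil T p ^+ M * (gamma K n *: Q T p ^+ M.*2.+2) * cp
          = gamma K n *: (Q T p ^+ M.+2 * cp).
  by rewrite -boundop_scalerAr -boundop_scalerAl e2 addnC Q_exp_cancell.
rewrite QX in X12; rewrite QZ in Z12.
have -> : A1 T s p =
   - (cs ^+ M.*2.+2 * R * t * L * cp ^+ M.*2.+1)
   - cs ^+ M.*2.+1 * R * t * L * cp ^+ M.*2.+2
   + cs ^+ M.*2.+1 * R * t ^+ 2 * L * cp ^+ M.*2.+1.
  by rewrite /A1 h1 hM !clifford_opX.
have z1 : \sum_(1 <= k < M.+1) 'C(M, k)%:R *:
    (up ^+ k * L * (para p ^+ (M.*2.+2 - 2 * k))%:Op) = Z1.
  by apply: eq_bigr => k _; rewrite clifford_opX scaler_nat.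
have z2 : \sum_(1 <= k < M.+1) 'C(M, k)%:R *:
    (up ^+ k * t * L * (para p ^+ (M.*2.+1 - 2 * k))%:Op) = Z2.
  by apply: eq_bigr => k _; rewrite clifford_opX scaler_nat.
have -> : B1 T s p =
    cs ^+ M.*2.+2 * R * Z1 - cs ^+ M.*2.+2 * R * Z2
    - cs ^+ M.*2.+1 * R * (t * Z1) + cs ^+ M.*2.+1 * R * (t * Z2).
  rewrite /B1 M'E h1 hM !clifford_opX.
  have tz1 : \sum_(1 <= k < M.+1) 'C(M, k)%:R *:
      (t * up ^+ k * L * (para p ^+ (M.*2.+2 - 2 * k))%:Op) = t * Z1.
    rewrite mulr_sumr; apply: eq_bigr => k _.
    by rewrite clifford_opX scaler_nat mulrnAr !mulrA.
  have tz2 : \sum_(1 <= k < M.+1) 'C(M, k)%:R *: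
      (t * up ^+ k * t * L * (para p ^+ (M.*2.+1 - 2 * k))%:Op) = t * Z2.
    rewrite mulr_sumr; apply: eq_bigr => k _.
    by rewrite clifford_opX scaler_nat mulrnAr !mulrA.
  by rewrite z1 z2 tz1 tz2.
have -> : C1 T s p =
     X1 * Z1 - X1 * Z2 - X2 * Z1 + X2 * Z2
     + X1 * L * cp ^+ M.*2.+2 - X1 * t * L * cp ^+ M.*2.+1 - X2 * L * cp ^+ M.*2.+2
     + X2 * t * L * cp ^+ M.*2.+1.
  rewrite /C1 M'E h1 hM !clifford_opX.
  have x1 : \sum_(1 <= k < M.+1) 'C(M, k)%:R *:
      ((para s ^+ (M.*2.+2 - 2 * k))%:Op * R * us ^+ k) = X1.
    by apply: eq_bigr => k _; rewrite clifford_opX scaler_nat.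
  have x2 : \sum_(1 <= k < M.+1) 'C(M, k)%:R *:
      ((para s ^+ (M.*2.+1 - 2 * k))%:Op * R * t * us ^+ k) = X2.
    by apply: eq_bigr => k _; rewrite clifford_opX scaler_nat.
  have x2' : \sum_(1 <= k < M.+1) 'C(M, k)%:R *:
      ((para s ^+ (M.*2.+2 - 2 * k - 1))%:Op * R * t * us ^+ k) = X2.
    by rewrite -x2; apply: eq_bigr => k _; rewrite subnAC subn1.
  have x1t : \sum_(1 <= k < M.+1) 'C(M, k)%:R *:
      ((para s ^+ (M.*2.+2 - 2 * k))%:Op * R * us ^+ k * t) = X1 * t.
    by rewrite mulr_suml; apply: eq_bigr => k _; rewrite clifford_opX scaler_nat mulrnAl.
  have x2t : \sum_(1 <= k < M.+1) 'C(M, k)%:R *: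
      ((para s ^+ (M.*2.+1 - 2 * k))%:Op * R * t * us ^+ k * t) = X2 * t.
    by rewrite mulr_suml; apply: eq_bigr => k _; rewrite clifford_opX scaler_nat mulrnAl.
  by rewrite x1 x2 x2' x1t x2t z1 z2.
rewrite hM !clifford_opX -/cs -/cp remainder_factor X12 Z12.
by rewrite boundop_scaleM; congr (_ *: _); apply: mulrA.
Qed.

End Remainder.

End Resolvent.

Theorem theorem5p5 (K : realType) (V : completeNormedModType K) (n h : nat)
    (n_gt3 : (3 < n)%N) (n_odd : odd n)
    (h_def : h = n.-1./2) (h_even : ~~ odd h)
    (T : paravector_op V n) (p s : 'rV[K]_n.+1)
    (p_res : Fresolvent_set T p) (s_res : Fresolvent_set T s)
    (s_notin : ~ para_sphere p s) :
  let R := FR T s in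
  let L := FL T p in
  let Tb := opbar T in
  let Qs := Q T s in
  let Qp := Q T p in
  let cs := (para s)%:Op in
  let cp := (para p)%:Op in
  R * SL T p + SR T s * L
  + gamma K n *: (
      - (cs * Qs ^+ (h + 2)./2 * Tb * Qp ^+ (h + 2)./2)
      - Qs ^+ (h + 2)./2 * Tb * Qp ^+ (h + 2)./2 * cp
      + Qs ^+ (h + 2)./2 * Tb ^+ 2 * Qp ^+ (h + 2)./2
      + (\sum_(0 <= i < h) Qs ^+ (h - i) * Qp ^+ (i + 1))
      + cs * (\sum_(0 <= i < h - 1 | i != (h - 2)./2)
                Qs ^+ (h - i) * Qp ^+ (i + 2)) * cp
      - cs * (\sum_(0 <= i < h - 1 | i != (h - 2)./2)
                Qs ^+ (h - i) * Tb * Qp ^+ (i + 2))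
      - (\sum_(0 <= i < h - 1 | i != (h - 2)./2)
           Qs ^+ (h - i) * Tb * Qp ^+ (i + 2)) * cp
      + (\sum_(0 <= i < h - 1 | i != (h - 2)./2)
           Qs ^+ (h - i) * Tb ^+ 2 * Qp ^+ (i + 2)))
  + (gamma K n)^-1 *: (
      A1 T s p + B1 T s p + C1 T s p
      + (para s ^+ h)%:Op * R * L * (para p ^+ h)%:Op)
  = ((R - L) * cp - (para_conj s)%:Op * (R - L))
    * ((para p ^+ 2 - (2 * para_re s) *: para p + (enormsq s)%:A)^-1)%:Op.
Proof.
have n_gt0 : (0 < n)%N by apply: leq_trans n_gt3.
pose M := (h - 2)./2.
have hM : h = M.*2.+2.
  have : (2 <= h)%N.
    by rewrite h_def; move: n_gt3 n_odd; case: (n) => [|[|[|[|[|m]]]]].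
  move: h_even; rewrite /M; case: (h) => [|[|k]] //= /negPn ev _.
  by rewrite !subSS subn0 even_halfK //; move: ev; rewrite negbK.
move=> R L Tb Qs Qp cs cp.
set a := cs - Tb; set b := cp - Tb.
have cQs : GRing.comm cs Qs by apply: Q_comm.
have cQp : GRing.comm cp Qp by apply: Q_comm.
have nE : n.+1./2 = h.+1 by rewrite h_def -{1}(prednK n_gt0).
have RE : R = gamma K n *: (Qs ^+ h.+1 * a) by rewrite /R /FR nE.
have LE : L = gamma K n *: (b * Qp ^+ h.+1) by rewrite /L /FL nE.
have g0 : gamma K n != 0.
  by rewrite /gamma !mulf_neq0 ?expf_neq0 ?oppr_eq0 ?oner_eq0 ?pnatr_eq0 -?lt0n ?fact_gt0.
have -> : A1 T s p + B1 T s p + C1 T s p + (para s ^+ h)%:Op * R * L * (para p ^+ h)%:Op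
  = gamma K n ^+ 2 *: (cs * Qs ^+ M.+2 * Qp ^+ M.+2 * cp).
  by rewrite h_def; apply: remainder_sum => //; rewrite -h_def.
rewrite scalerA expr2 mulKf //.
pose Y := two_point_sum a b Qs Qp h.
have -> : R * SL T p = gamma K n *: (Qs ^+ h.+1 * a * b * Qp).
  by rewrite RE -boundop_scalerAl !mulrA.
have -> : SR T s * L = gamma K n *: (Qs * a * b * Qp ^+ h.+1).
  by rewrite LE -boundop_scalerAr !mulrA.
(* The block of remainder terms is the summand of index M of
   s (sum Qs^(h-i) Qp^(i+2)) p; the other three terms of index M are the ones
   that the statement writes apart, with the exponent (h+2)/2 = M + 2. *)
have K_def : (h + 2)./2 = M.+2 by rewrite addn2 hM /= doubleK.
have M_def : (h - 2)./2 = M by [].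
rewrite -!scalerDr K_def M_def regroup_sandwiches.
have comm_l i : GRing.comm cs (Qs ^+ i) by apply: commrX.
have comm_r i : GRing.comm cp (Qp ^+ i) by apply: commrX.
have -> : cs * Qs ^+ M.+2 * Qp ^+ M.+2 * cp - cs * Qs ^+ M.+2 * Tb * Qp ^+ M.+2
    - Qs ^+ M.+2 * Tb * Qp ^+ M.+2 * cp + Qs ^+ M.+2 * Tb ^+ 2 * Qp ^+ M.+2
    = Qs ^+ M.+2 * a * b * Qp ^+ M.+2.
  exact/esym/mulr_sandwich.
have -> : cs * (\sum_(0 <= i < h - 1 | i != M) Qs ^+ (h - i) * Qp ^+ (i + 2)) * cp
    - cs * (\sum_(0 <= i < h - 1 | i != M) Qs ^+ (h - i) * Tb * Qp ^+ (i + 2))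
    - (\sum_(0 <= i < h - 1 | i != M) Qs ^+ (h - i) * Tb * Qp ^+ (i + 2)) * cp
    + (\sum_(0 <= i < h - 1 | i != M) Qs ^+ (h - i) * Tb ^+ 2 * Qp ^+ (i + 2))
  = \sum_(0 <= i < h - 1 | i != M) Qs ^+ (h - i) * a * b * Qp ^+ (i + 2).
  rewrite !mulr_sumr !mulr_suml -!sumrB -big_split; apply: eq_bigr => i _.
  by rewrite [RHS]mulr_sandwich // !mulrA.
have -> : Qs ^+ h.+1 * a * b * Qp
    + (Qs ^+ M.+2 * a * b * Qp ^+ M.+2
       + \sum_(0 <= i < h - 1 | i != M) Qs ^+ (h - i) * a * b * Qp ^+ (i + 2))
    + Qs * a * b * Qp ^+ h.+1
    + \sum_(0 <= i < h) Qs ^+ (h - i) * Qp ^+ (i + 1) = Y.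
  (* The end terms i = 0 and i = h of Y come from R S_L(p) and S_R(s) L. *)
  rewrite /Y /two_point_sum; congr (_ + _); last first.
    by apply: eq_bigr => i _; rewrite addn1.
  rewrite big_nat_recr //= subSnn expr1; congr (_ + _).
  rewrite [in RHS]hM big_nat_recl //= -hM subn0 expr1; congr (_ + _).
  rewrite hM subn1 [RHS](bigD1_seq M) ?iota_uniq ?mem_index_iota //=; last first.
    by rewrite ltnS -addnn leq_addr.
  congr (_ + _).
    by congr (Qs ^+ _ * _ * _ * _); rewrite subSS -addnn -!addSn addnK.
  by apply: eq_bigr => i _; rewrite subSS addn2.
have YE : Y * cp - cs * Y = Qs ^+ h.+1 * a - b * Qp ^+ h.+1.
  have [_ QPs] := Q_inv s_res; have [PQp _] := Q_inv p_res.
  apply: (two_point_sum_eq (t := op T)) => //.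
  - by rewrite Fpencil_left.
  - by rewrite Fpencil_right.
  by rewrite /a opprB /b subrKA.
have -> : R - L = gamma K n *: (Y * cp - cs * Y) by rewrite RE LE YE scalerBr.
set w := _ + (enormsq s)%:A.
have wu : w \is a GRing.unit by apply: sphere_poly_unit.
rewrite -boundop_scalerAl -boundop_scalerAr -scalerBr -boundop_scalerAl.
congr (_ *: _); set csb := (para_conj s)%:Op.
rewrite -mulr_sphere_poly.
- have -> : cp ^+ 2 - (cs + csb) * cp + csb * cs = w%:Op.
    by rewrite /w sphere_polyE rmorphD rmorphB rmorphXn !rmorphM (rmorphD _ (para s)).
  by rewrite -mulrA -rmorphM divrr // rmorph1 mulr1.
- by rewrite /cs /csb -rmorphD paraDconj; apply: scalar_op_comm.
by rewrite /cs /csb -rmorphM para_conj_mul; apply: scalar_op_comm.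
Qed.
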